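(* For every integer $d\ge 2$ there exists a constant $c_d>0$ depending only on $d$ such that the following holds. Let $\varepsilon\in(0,1)$ and $n_1,\ldots,n_d\in\mathbb{N}$, and set $$r=\left\lceil \frac{c_d}{\varepsilon^2}\log\Big(2e\prod_{s=1}^{d} n_s\Big)\right\rceil\in\mathbb{N},$$ where $e$ is Euler's number. Then for every tensor $\mathcal{A}\in\mathbb{R}^{n_1\times\cdots\times n_d}$ there exists a tensor $\mathcal{B}\in\mathbb{R}^{n_1\times\cdots\times n_d}$ all components of whose TT rank are at most $r$ such that $$\|\mathcal{A}-\mathcal{B}\|_{\max}\le \varepsilon\cdot\gamma^{\mathrm{CP}}(\mathcal{A}).$$
   Context: $\mathbb{N}$ denotes the positive integers, $[n]=\{1,\ldots,n\}$, and $\|\mathcal{A}\|_{\max}=\max_{i_1,\ldots,i_d}|\mathcal{A}(i_1,\ldots,i_d)|$. Tensor-train (TT) factorization: a tensor $\mathcal{B}\in\mathbb{R}^{n_1\times\cdots\times n_d}$ is represented in the TT format with TT cores $\mathcal{G}_s\in\mathbb{R}^{r_{s-1}\times n_s\times r_s}$, $s\in[d]$, with $r_0=r_d=1$ and $r_1,\ldots,r_{d-1}\in\mathbb{N}$, if for all indices $$\mathcal{B}(i_1,\ldots,i_d)=\sum_{\alpha_1=1}^{r_1}\cdots\sum_{\alpha_{d-1}=1}^{r_{d-1}}\mathcal{G}_1(1,i_1,\alpha_1)\mathcal{G}_2(\alpha_1,i_2,\alpha_2)\cdots\mathcal{G}_d(\alpha_{d-1},i_d,1).$$ The tuple $(r_1,\ldots,r_{d-1})$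 is the TT rank of the factorization. The componentwise smallest TT rank among all exact TT factorizations of $\mathcal{B}$ is called the TT rank of $\mathcal{B}$. CP format: $\mathcal{A}$ is represented in the canonical polyadic (CP) format with factors $\mathbf{C}_s\in\mathbb{R}^{n_s\times k}$, $s\in[d]$, $k\in\mathbb{N}$ arbitrary, if for all indices $$\mathcal{A}(i_1,\ldots,i_d)=\sum_{\alpha=1}^{k}\mathbf{C}_1(i_1,\alpha)\mathbf{C}_2(i_2,\alpha)\cdots\mathbf{C}_d(i_d,\alpha).$$ For a matrix $\mathbf{C}$, $\|\mathbf{C}\|_{2,\infty}=\max_i\|\mathbf{C}(i,:)\|_2$ is the maximal Euclidean norm of its rows. The CP factorization quasinorm is $$\gamma^{\mathrm{CP}}(\mathcal{A})=\inf\Big\{\prod_{s=1}^{d}\|\mathbf{C}_s\|_{2,\infty}\Big\},$$ the infimum being over all CP representations $\{\mathbf{C}_s\}_{s=1}^d$ of $\mathcal{A}$ (with arbitrary $k$). *)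

(* Defs.v *)
From mathcomp Require Import all_boot all_order all_algebra.
From mathcomp Require Import classical_sets reals.

Set Implicit Arguments.
Unset Strict Implicit.
Unset Printing Implicit Defensive.

Import Order.TTheory GRing.Theory Num.Theory.
Local Open Scope classical_set_scope.
Local Open Scope ring_scope.

(* Modes, indices and bonds are counted from 0, as usual with ordinals. *)
Notation multi_index n := {dffun forall s, 'I_(n s)}.

Notation tensor R n := {ffun multi_index n -> R}.

Definition max_norm (R : realType) (d : nat) (n : 'I_d -> nat)
    (A : tensor R n) : R :=
  \big[Num.max/0]_(i : multi_index n) `|A i|.

(* The core of mode s sits between the bonds s and s + 1 among 0, ..., d. *)
Definition bondl (d : nat) (s : 'I_d) : 'I_d.+1 := widen_ord (leqnSn d) s.
Definition bondr (d : nat) (s : 'I_d) : 'I_d.+1 := lift ord0 s.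

Definition tt_cores (R : realType) (d : nat) (n : 'I_d -> nat)
    (rk : 'I_d.+1 -> nat) : Type :=
  forall s : 'I_d, 'I_(rk (bondl s)) -> 'I_(n s) -> 'I_(rk (bondr s)) -> R.

(* Rank tuples carry the boundary entries r_0 and r_d. As these equal 1, the
   indices alpha_0 and alpha_d of the sum below take a single value. *)
Definition tt_rank_tuple (d : nat) (rk : 'I_d.+1 -> nat) : Prop :=
  [/\ rk ord0 = 1%N, rk ord_max = 1%N & forall t, (0 < rk t)%N].

Definition tt_represents (R : realType) (d : nat) (n : 'I_d -> nat)
    (rk : 'I_d.+1 -> nat) (G : tt_cores R n rk) (B : tensor R n) : Prop :=
  forall i : multi_index n,
    B i = \sum_(alpha : multi_index rk)
            \prod_(s < d) G s (alpha (bondl s)) (i s) (alpha (bondr s)).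

Definition has_tt_factorization (R : realType) (d : nat) (n : 'I_d -> nat)
    (B : tensor R n) (rk : 'I_d.+1 -> nat) : Prop :=
  tt_rank_tuple rk /\ exists G : tt_cores R n rk, tt_represents G B.

Definition is_tt_rank (R : realType) (d : nat) (n : 'I_d -> nat)
    (B : tensor R n) (rk : 'I_d.+1 -> nat) : Prop :=
  has_tt_factorization B rk /\
  forall rk', has_tt_factorization B rk' -> forall t, (rk t <= rk' t)%N.

Definition cp_represents (R : realType) (d : nat) (n : 'I_d -> nat) (k : nat)
    (C : forall s : 'I_d, 'M[R]_(n s, k)) (A : tensor R n) : Prop :=
  forall i : multi_index n,
    A i = \sum_(alpha < k) \prod_(s < d) C s (i s) alpha.

Definition norm2inf (R : realType) (m k : nat) (C : 'M[R]_(m, k)) : R :=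
  \big[Num.max/0]_(i < m) Num.sqrt (\sum_(j < k) C i j ^+ 2).

(* Every tensor has a CP representation and the products are nonnegative, so
   this is the infimum of a nonempty set that is bounded below. *)
Definition gammaCP (R : realType) (d : nat) (n : 'I_d -> nat)
    (A : tensor R n) : R :=
  inf [set x | exists (k : nat) (C : forall s : 'I_d, 'M[R]_(n s, k)),
    [/\ (0 < k)%N, cp_represents C A & x = \prod_(s < d) norm2inf (C s)]].

(* Main.v *)
Require Import Defs.
From mathcomp Require Import all_boot all_order all_algebra.
From mathcomp Require Import ring lra.
From mathcomp Require Import boolp classical_sets reals sequences exp.

Set Implicit Arguments.
Unset Strict Implicit.
Unset Printing Implicit Defensive.

Import Order.TTheory GRing.Theory Num.Theory.
Local Open Scope ring_scope.

(* Take a nearly optimal CP representation and write c_s(i_s) for the rows of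
   its factors, so that A(i) is the sum of the entries of the Hadamard product
   of the c_s(i_s). Insert a random k x k matrix Q_t of rank r with mean 1
   between consecutive modes:
     L_0 = c_0,  L_(t+1) = c_(t+1) o (Q_t L_t),  B = sum of the entries of L_(d-1).
   The unfolding of B at a bond factors through some Q_t, so its rank is at most
   r, and the TT ranks of a tensor are the ranks of its unfoldings. With
   Q = X X^T / r for a sign matrix X, the entries of Q x are at most
   <x, Q x>^(1/2) deterministically, whence |L_(t+1)| <= 2 |c_(t+1)| |L_t|
   as soon as <L_t, Q_t L_t> <= 2 |L_t|^2. The error telescopes into the terms
   <y, (Q_t - 1) L_t>, with y the Hadamard product of the remaining rows, and a
   Johnson-Lindenstrauss union bound over the multi-indices makes each of them
   at most eps |y| |L_t|. *)

(** * TT ranks and unfoldings *)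

(** Splits at bond [t] without types of partial multi-indices: both halves are full multi-indices,
    of which one part is ignored. *)
Definition glue (d : nat) (n : 'I_d -> nat) (t : nat) (i j : multi_index n) :
    multi_index n :=
  finfun (fun s : 'I_d => if (s < t)%N then i s else j s).

Lemma glueE (d : nat) (n : 'I_d -> nat) (t : nat) (i j : multi_index n)
    (s : 'I_d) : glue t i j s = if (s < t)%N then i s else j s.
Proof. by rewrite ffunE. Qed.

Lemma glue_swapK (d : nat) (n : 'I_d -> nat) (t : nat) :
  involutive (fun p : multi_index n * multi_index n =>
                (glue t p.1 p.2, glue t p.2 p.1)).
Proof.
by move=> [i j]; congr (_, _); apply/ffunP=> s; rewrite !glueE; case: ltnP.
Qed.

(** Reindexing the double sum by the involution that exchanges the parts of [i] and [j] from [t] on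
    turns [F i * K j] into [F i * K i]; the variable [j], now free, contributes [#|D|]. *)
Lemma sum_glue (R : realType) (d : nat) (n : 'I_d -> nat) (t : nat)
    (D : {set multi_index n}) (F K : multi_index n -> R) :
  {in D &, forall i j, glue t i j \in D} ->
  {in D &, forall i j, F (glue t i j) = F i} ->
  {in D &, forall i j, K (glue t i j) = K j} ->
  (\sum_(i in D) F i) * (\sum_(j in D) K j) =
  #|D|%:R * \sum_(i in D) F i * K i.
Proof.
move=> Dg Fg Kg; transitivity (\sum_(i in D) \sum_(j in D) F i * K i); last first.
  rewrite mulr_sumr; apply: eq_bigr => i Di.
  by rewrite sumr_const mulr_natl.
rewrite mulr_suml [RHS]pair_big /= (reindex_inj (inv_inj (@glue_swapK d n t))) /=.
under eq_bigr => i _ do rewrite mulr_sumr.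
rewrite pair_big /=; apply: congr_big => //.
  case=> i j /=; apply/andP/andP=> -[Di Dj]; split; rewrite ?Dg //.
    have := Dg _ _ Di Dj; have := glue_swapK t (i, j) => /= -[<- _] _.
    exact: Dg.
  by have := glue_swapK t (i, j) => /= -[_ <-]; exact: Dg.
by case=> i j /= /andP[Di Dj]; rewrite Fg // Kg.
Qed.

(** The usual unfolding with rows and columns repeated, which keeps its rank and gives all bonds the
    same matrix type. *)
Definition unfolding (R : realType) (d : nat) (n : 'I_d -> nat)
    (B : tensor R n) (t : nat) : 'M[R]_(#|{: multi_index n}|) :=
  \matrix_(p, q) B (glue t (enum_val p) (enum_val q)).

Lemma unfolding_first (R : realType) (d : nat) (n : 'I_d -> nat)
    (B : tensor R n) p q : unfolding B 0 p q = B (enum_val q).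
Proof. by rewrite mxE; congr (B _); apply/ffunP=> s; rewrite glueE. Qed.

Lemma unfolding_last (R : realType) (d : nat) (n : 'I_d -> nat)
    (B : tensor R n) p q : unfolding B d p q = B (enum_val p).
Proof. by rewrite mxE; congr (B _); apply/ffunP=> s; rewrite glueE ltn_ord. Qed.

Lemma rank_unfolding_first (R : realType) (d : nat) (n : 'I_d -> nat)
    (B : tensor R n) : (\rank (unfolding B 0) <= 1)%N.
Proof.
apply: leq_trans (rank_leq_row (\row_q B (enum_val q))).
apply: mxrankS; apply/row_subP=> p; apply/submxP; exists 1%:M.
by rewrite mul1mx; apply/rowP=> q; rewrite [LHS]mxE unfolding_first mxE.
Qed.

Lemma rank_unfolding_last (R : realType) (d : nat) (n : 'I_d -> nat)
    (B : tensor R n) : (\rank (unfolding B d) <= 1)%N.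
Proof.
apply: leq_trans (rank_leq_col (\col_p B (enum_val p))).
have -> : unfolding B d = (\col_p B (enum_val p)) *m const_mx 1.
  by apply/matrixP=> p q; rewrite unfolding_last !mxE big_ord1 !mxE mulr1.
exact: mxrankM_maxl.
Qed.

(** Once the index at bond [t] is fixed to [a], the TT product splits into a head and a tail factor,
    so the unfolding is a product with inner dimension [rk t]. Both sums range over full index
    tuples, whence the weight [#|D a|^-1] in [Y]. *)
Lemma rank_unfolding_le (R : realType) (d : nat) (n : 'I_d -> nat)
    (B : tensor R n) (rk : 'I_d.+1 -> nat) (t : 'I_d.+1) :
  has_tt_factorization B rk -> (\rank (unfolding B t) <= rk t)%N.
Proof.
case=> _ [G BG].
pose term (s : 'I_d) (i : multi_index n) (al : multi_index rk) :=
  G s (al (bondl s)) (i s) (al (bondr s)).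
pose F i al := \prod_(s < d | (s < t)%N) term s i al.
pose K i al := \prod_(s < d | ~~ (s < t)%N) term s i al.
pose D a : {set multi_index rk} := [set al : multi_index rk | al t == a].
have DP a al : al \in D a -> al t = a by rewrite inE => /eqP.
pose X : 'M[R]_(_, rk t) :=
  \matrix_(p < #|{: multi_index n}|, a < rk t) \sum_(al in D a) F (enum_val p) al.
pose Y : 'M[R]_(rk t, _) :=
  \matrix_(a < rk t, q < #|{: multi_index n}|)
    ((#|D a|%:R)^-1 * \sum_(al in D a) K (enum_val q) al).
suff -> : unfolding B t = X *m Y by rewrite (leq_trans (mxrankM_maxl _ _))// rank_leq_col.
apply/matrixP=> p q; rewrite !mxE BG.
set i := enum_val p; set j := enum_val q.
rewrite (partition_big (fun al : multi_index rk => al t) xpredT) //=.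
apply: eq_bigr => a _; rewrite !mxE mulrCA (@sum_glue R _ _ t).
- transitivity (\sum_(al in D a) F i al * K j al).
    apply: eq_big => [al|al _]; first by rewrite inE.
    rewrite (bigID (fun s : 'I_d => (s < t)%N)) /=; congr (_ * _).
      by apply: eq_bigr => s st; rewrite glueE st.
    by apply: eq_bigr => s /negPf st; rewrite glueE st.
  case: (posnP #|D a|) => [D0|D0].
    by rewrite D0 invr0 mul0r (cards0_eq D0) big_set0.
  by rewrite mulKf // pnatr_eq0 -lt0n.
- by move=> al be /DP ala /DP bea; rewrite inE glueE ltnn bea.
- move=> al be /DP ala /DP bea; apply: eq_bigr => s st.
  rewrite /term !glueE /= st.
  case: ltnP => // ts; congr G.
  (* [F] reads the bonds up to [t]; the only one that [glue] takes from [be] is [t] itself, where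
     [al] and [be] both equal [a]. *)
  have E u : u = t -> be u = al u by move=> ->; rewrite ala bea.
  by apply: E; apply: val_inj; apply/eqP; rewrite eqn_leq ts andbT /= /bump leq0n.
- move=> al be /DP ala /DP bea; apply: eq_bigr => s st.
  rewrite /term !glueE /= (negPf st).
  by rewrite ifN //; apply: contra st; apply: leq_trans; rewrite /bump leq0n.
Qed.

Lemma card_multi_index (d : nat) (rk : 'I_d -> nat) :
  #|{: multi_index rk}| = (\prod_(u < d) rk u)%N.
Proof.
rewrite card_dep_ffun foldrE big_image /=; apply: eq_bigr => u _.
by rewrite card_ord.
Qed.

Definition upd (d : nat) (rk : 'I_d -> nat) (u : 'I_d) (al : multi_index rk)
    (b : 'I_(rk u)) : multi_index rk := finfun (dfwith al b).

Lemma upd_in (d : nat) (rk : 'I_d -> nat) (u : 'I_d) (al : multi_index rk)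
    (b : 'I_(rk u)) : upd al b u = b.
Proof. by rewrite ffunE dfwith_in. Qed.

Lemma upd_out (d : nat) (rk : 'I_d -> nat) (u v : 'I_d) (al : multi_index rk)
    (b : 'I_(rk u)) : u != v -> upd al b v = al v.
Proof. by move=> uv; rewrite ffunE dfwith_out. Qed.

Lemma upd_swapK (d : nat) (rk : 'I_d -> nat) (u : 'I_d) :
  involutive (fun p : multi_index rk * 'I_(rk u) => (upd p.1 p.2, p.1 u)).
Proof.
move=> [al b] /=; rewrite upd_in; congr (_, _); apply/ffunP=> v.
by have [<-|uv] := eqVneq u v; rewrite ?upd_in // !upd_out.
Qed.

(** Reindexing by the involution [upd_swapK] shows that each multi-index is counted [rk u] times. *)
Lemma sum_upd (R : realType) (d : nat) (rk : 'I_d -> nat) (u : 'I_d)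
    (F : multi_index rk -> R) :
  \sum_al \sum_(b < rk u) F (upd al b) = (rk u)%:R * \sum_al F al.
Proof.
rewrite pair_big /= (reindex_inj (inv_inj (@upd_swapK _ rk u))) /=.
rewrite (eq_bigr (fun p => F p.1)) => [|p _]; last first.
  by have /(congr1 fst) /= -> := upd_swapK p.
rewrite -(pair_big xpredT xpredT (fun al b => F al)) /= mulr_sumr.
by apply: eq_bigr => al _; rewrite sumr_const card_ord mulr_natl.
Qed.

(* Freeing the bond s + 1 multiplies the number of terms by its size; hence the
   cardinalities in the invariant, instead of sums over partial multi-indices. *)
Lemma tt_contraction (R : realType) (d : nat) (rk : 'I_d.+1 -> nat)
    (g : forall s : 'I_d, 'I_(rk (bondl s)) -> 'I_(rk (bondr s)) -> R)
    (V : forall u : 'I_d.+1, 'I_(rk u) -> R) :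
  tt_rank_tuple rk ->
  (forall s a, V (bondl s) a = \sum_b g s a b * V (bondr s) b) ->
  forall a0, V ord0 a0 =
    \sum_(al : multi_index rk)
      (\prod_(s < d) g s (al (bondl s)) (al (bondr s))) * V ord_max (al ord_max).
Proof.
case=> rk0 _ rkP Vg a0.
(* [S u] contracts the cores before bond [u] and leaves the later bonds free, so it is [V ord0 a0]
   times the sizes of the bonds after [u]. [SI] is this relation, cross-multiplied. *)
pose S (u : 'I_d.+1) := \sum_(al : multi_index rk)
  (\prod_(s < d | (s < u)%N) g s (al (bondl s)) (al (bondr s))) * V u (al u).
have SE s : S (bondl s) = (rk (bondr s))%:R * S (bondr s).
  rewrite -sum_upd; apply: eq_bigr => al _; rewrite Vg mulr_sumr.
  apply: eq_bigr => b _; rewrite upd_in mulrA; congr (_ * _).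
  rewrite (bigD1 s (P := fun s' => (s' < bondr s)%N)) /=; last by rewrite /bump.
  have lr : bondr s != bondl s.
    by rewrite -val_eqE /= /bump leq0n add1n gtn_eqF.
  rewrite upd_in upd_out // mulrC; congr (_ * _).
  apply: eq_big => [s'|s' ss].
    by rewrite /bump leq0n add1n ltnS -val_eqE /= ltn_neqAle andbC.
  rewrite !upd_out // -val_eqE /= /bump !leq0n ?add1n ?eqSS.
  - by rewrite gtn_eqF.
  - by rewrite gtn_eqF// ltnS ltnW.
have SI m : forall u : 'I_d.+1, u = m :> nat ->
    S ord0 * \prod_(v < d.+1 | (u < v)%N) (rk v)%:R =
    S u * \prod_(v < d.+1 | (0 < v)%N) (rk v)%:R.
  elim: m => [|m IH] u um; first by rewrite (_ : u = ord0) //; apply: val_inj.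
  have md : (m < d)%N by have := ltn_ord u; rewrite um.
  pose s := Ordinal md.
  have su : bondr s = u by apply: val_inj; rewrite /= /bump leq0n um.
  have := IH (bondl s) erefl; rewrite SE su (bigD1 u) /=; last by rewrite um.
  move=> E; have rku : (rk u)%:R != 0 :> R by rewrite pnatr_eq0 -lt0n rkP.
  apply: (mulfI rku); rewrite [RHS]mulrA -E mulrCA; congr (_ * (_ * _)).
  by apply: eq_bigl => v; rewrite -val_eqE /= um ltn_neqAle andbC eq_sym.
have := SI _ ord_max erefl.
rewrite big_pred0 ?mulr1; last by move=> v; rewrite ltnNge -ltnS ltn_ord.
have -> : S ord0 = V ord0 a0 * \prod_(v < d.+1 | (0 < v)%N) (rk v)%:R.
  have VC b : V ord0 b = V ord0 a0.
    congr V; apply: val_inj.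
    have := leq_trans (ltn_ord b) (eq_leq rk0).
    have := leq_trans (ltn_ord a0) (eq_leq rk0).
    by rewrite /= !ltnS !leqn0 => /eqP -> /eqP ->.
  rewrite /S (eq_bigr (fun=> V ord0 a0)) => [|al _]; last first.
    by rewrite big_pred0 ?mul1r.
  rewrite sumr_const card_multi_index -mulr_natr natr_prod (bigD1 ord0) //= rk0 mul1r.
  by congr (_ * _); apply: eq_bigl => v; rewrite -val_eqE /= lt0n.
have P0 : \prod_(v < d.+1 | (0 < v)%N) (rk v)%:R != 0 :> R.
  by apply/prodf_neq0 => v _; rewrite pnatr_eq0 -lt0n rkP.
move/(mulIf P0) => ->; apply: eq_bigr => al _; congr (_ * _).
by apply: eq_bigl => s; rewrite ltn_ord.
Qed.

(** Read off from the normal form [L *m pid_mx r *m U] of [M]: the rows of [V] span the row space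
    and [M *m W] holds the coordinates. Padding to [p] rows lets a bond of rank 0 have size 1. *)
Lemma row_space_basis (F : fieldType) (m n p : nat) (M : 'M[F]_(m, n)) :
  (\rank M <= p)%N ->
  exists (V : 'M_(p, n)) (W : 'M_(n, p)), (V <= M)%MS /\ M *m W *m V = M.
Proof.
move: (rank_leq_row M) (rank_leq_col M) (mulmx_ebase M) (col_ebase_unit M).
move: (row_ebase_unit M); move: (col_ebase M) (row_ebase M) (\rank M) => L U r.
move=> Uu rm rn <- Lu rp; exists (pid_mx r *m U), (invmx U *m pid_mx r); split.
  apply/submxP; exists (pid_mx r *m invmx L).
  by rewrite !mulmxA mulmxKV // pid_mx_id.
rewrite -!mulmxA mulKVmx //; congr (L *m _).
by rewrite !mulmxA !pid_mx_id.
Qed.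

(** Moves mode [s] across the cut when passing from bond [s] to the next one. *)
Lemma glue_upd (d : nat) (n : 'I_d -> nat) (s : 'I_d) (i j : multi_index n)
    (x : 'I_(n s)) : glue s i (upd j x) = glue s.+1 (upd i x) j.
Proof.
apply/ffunP=> u; rewrite !glueE ltnS; have [<-|su] := eqVneq s u.
  by rewrite ltnn leqnn !upd_in.
by rewrite !upd_out // ltn_neqAle val_eqE eq_sym su.
Qed.

Lemma upd_id (d : nat) (n : 'I_d -> nat) (s : 'I_d) (i : multi_index n) :
  upd i (i s) = i.
Proof.
by apply/ffunP=> u; have [<-|su] := eqVneq s u; rewrite ?upd_in ?upd_out.
Qed.

(** Minimality is [rank_unfolding_le]. For existence, choose rows [V] spanning the row space of each
    unfolding. Fixing mode [s] in such a row at bond [s] gives a vector in the row space at the next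
    bond; its coordinates there form the core, and [tt_contraction] multiplies the cores out to
    [B]. *)
Lemma is_tt_rank_unfolding (R : realType) (d : nat) (n : 'I_d -> nat)
    (B : tensor R n) : (0 < d)%N -> (forall s, 0 < n s)%N ->
  is_tt_rank B (fun t : 'I_d.+1 => maxn 1 (\rank (unfolding B t))).
Proof.
move=> d0 n0; set rk := fun _ : 'I_d.+1 => _; split; last first.
  move=> rk' tt' t; rewrite geq_max (rank_unfolding_le _ tt') andbT.
  by case: tt' => -[_ _].
pose N := #|{: multi_index n}|.
pose i0 : multi_index n := finfun (fun s => Ordinal (n0 s)).
have max0 : (ord_max : 'I_d.+1) != ord0 by rewrite -val_eqE /= -lt0n.
have rk0 : rk ord0 = 1%N by apply/maxn_idPl; exact: rank_unfolding_first.
have rkd : rk ord_max = 1%N by apply/maxn_idPl; exact: rank_unfolding_last.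
have rkP : tt_rank_tuple rk by split=> // t; rewrite leq_maxl.
(* At the end bonds [V] is prescribed: [B] itself at bond 0 and the constant 1 at bond [d], where
   the contraction starts and ends. *)
have bases t : exists VW : 'M[R]_(rk t, N) * 'M[R]_(N, rk t),
    [/\ t != ord_max -> (VW.1 <= unfolding B t)%MS,
        t != ord0 -> unfolding B t *m VW.2 *m VW.1 = unfolding B t,
        t = ord0 -> VW.1 = \matrix_(a, q) B (enum_val q)
      & t = ord_max -> VW.1 = const_mx 1].
  have [->|t0] := eqVneq t ord0.
    exists (\matrix_(a, q) B (enum_val q), 0); split=> // [_|E]; last first.
      by rewrite -E eqxx in max0.
    apply/row_subP=> a; set v := row a _.
    have -> : v = row (enum_rank i0) (unfolding B 0); last exact: row_sub.
    by apply/rowP=> q; rewrite [RHS]mxE unfolding_first !mxE.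
  have [td|td] := eqVneq t ord_max.
    (* All columns of the last unfolding are equal, so [W] just picks the column of [i0]. *)
    rewrite td; exists (const_mx 1, \matrix_(q, a) (q == enum_rank i0)%:R).
    split=> [|_|E|] //; last by rewrite E eqxx in max0.
    rewrite /=; apply/matrixP=> p q; rewrite mxE (eq_bigr (fun=> B (enum_val p))).
      by rewrite sumr_const card_ord rkd unfolding_last.
    move=> a _; rewrite [const_mx _ _ _]mxE mulr1 mxE (bigD1 (enum_rank i0)) //=.
    rewrite unfolding_last mxE eqxx mulr1 big1 ?addr0 // => r /negPf r0.
    by rewrite !mxE r0 mulr0.
  have [V [W [VM MWV]]] := row_space_basis (leq_maxr 1 (\rank (unfolding B t))).
  by exists (V, W); split=> // E; rewrite E eqxx in t0 td.
have {bases} [VW VWP] := fin_all_exists bases.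
split=> //; pose V t := (VW t).1; pose W t := (VW t).2.
pose G : tt_cores R n rk := fun s a x b =>
  \sum_q V (bondl s) a (enum_rank (upd (enum_val q) x)) * W (bondr s) q b.
exists G.
move=> i; pose v u a := V u a (enum_rank i).
have a0 : 'I_(rk ord0) by rewrite rk0; exact: ord0.
have -> : B i = v ord0 a0.
  have [_ _ V0 _] := VWP ord0.
  by rewrite /v /V V0 // mxE enum_rankK.
rewrite (tt_contraction (g := fun s a b => G s a (i s) b) rkP).
  have [_ _ _ Vd] := VWP ord_max.
  by apply: eq_bigr => al _; rewrite /v /V Vd // mxE mulr1.
move=> s a.
pose x : 'rV[R]_N := \row_q V (bondl s) a (enum_rank (upd (enum_val q) (i s))).
(* By [glue_upd], a row of the unfolding at bond [s] with mode [s] fixed to [i s] is a row of the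
   unfolding at the next bond. *)
have [y xy] : exists y, x = y *m unfolding B (bondr s).
  have ld : bondl s != ord_max by rewrite -val_eqE /= ltn_eqF.
  have [/(_ ld)/submxP[X VX] _ _ _] := VWP (bondl s).
  exists (\sum_p X a p *: delta_mx 0 (enum_rank (upd (enum_val p) (i s)))).
  apply/rowP=> q; rewrite mulmx_suml summxE [LHS]mxE /V VX mxE; apply: eq_bigr => p _.
  rewrite -scalemxAl mxE -rowE !mxE; congr (_ * B _).
  by rewrite !enum_rankK glue_upd /bondr /= /bump leq0n.
have r0 : bondr s != ord0 by rewrite -val_eqE.
have [_ /(_ r0) MWV _ _] := VWP (bondr s).
have xWV : x *m W (bondr s) *m V (bondr s) = x by rewrite xy -!mulmxA (mulmxA _ (W _)) MWV.
have := congr1 (fun z : 'rV__ => z 0 (enum_rank i)) xWV.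
rewrite /= [X in _ = X]mxE enum_rankK upd_id /v => <-.
rewrite mxE; apply: eq_bigr => b _; congr (_ * _); rewrite mxE.
by apply: eq_bigr => q _; rewrite mxE.
Qed.

(** * Random sign projections *)

(* The bound passes from x to 2x because cosh (2x) = 2 (cosh x)^2 - 1 and
   2u - 1 <= u^2; near 0 it follows from exp x <= 1 / (1 - x). *)
Lemma cosh_le_expR_sqr (R : realType) (x : R) :
  expR x + expR (- x) <= 2 * expR (2 * x ^+ 2).
Proof.
have small y : `|y| <= 1 / 2 -> expR y + expR (- y) <= 2 * expR (2 * y ^+ 2) :> R.
  rewrite ler_norml => /andP[y1 y2].
  have E z : z <= 1 / 2 -> expR z <= (1 - z)^-1 :> R.
    move=> z2; have z0 : 0 < 1 - z by lra.
    rewrite -[expR z]invrK -expRN lef_pV2 ?posrE ?expR_gt0 //.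
    exact: expR_ge1Dx.
  have := expR_ge1Dx (2 * y ^+ 2); have := E y y2; have := E (- y).
  rewrite opprK => /(_ ltac:(lra)) H1 H2 H3.
  have y0 : 0 < 1 - y by lra.
  have y'0 : 0 < 1 + y by lra.
  suff : (1 - y)^-1 + (1 + y)^-1 <= 2 * (1 + 2 * y ^+ 2) by lra.
  have -> : (1 - y)^-1 + (1 + y)^-1 = 2 / ((1 - y) * (1 + y)).
    by field; rewrite !gt_eqF.
  rewrite ler_pdivrMr ?mulr_gt0 //.
  have : y ^+ 2 <= 1 / 4 by nra.
  have : 0 <= y ^+ 2 by exact: sqr_ge0.
  nra.
have double m y : `|y| <= 2 ^+ m / 2 -> expR y + expR (- y) <= 2 * expR (2 * y ^+ 2) :> R.
  elim: m y => [|m IH] y ym; first by apply: small; rewrite expr0 in ym.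
  have ym2 : `|y / 2| <= 2 ^+ m / 2.
    by rewrite normrM [`|2^-1|]ger0_norm; rewrite exprSr in ym; lra.
  have {IH} := IH _ ym2.
  have -> : expR y = expR (y / 2) ^+ 2 by rewrite -expRM_natr; congr expR; lra.
  have -> : expR (- y) = expR (- (y / 2)) ^+ 2.
    by rewrite -expRM_natr; congr expR; lra.
  have -> : expR (2 * y ^+ 2) = expR (2 * (y / 2) ^+ 2) ^+ 4.
    by rewrite -expRM_natr; congr expR; field.
  have := expR_gt0 (y / 2); have := expR_gt0 (- (y / 2)).
  have : expR (y / 2) * expR (- (y / 2)) = 1 by rewrite -expRD subrr expR0.
  move: (expR (y / 2)) (expR (- (y / 2))) (expR (2 * (y / 2) ^+ 2)) => a b u.
  move=> ab b0 a0 abu.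
  have ab2 : (a + b) ^+ 2 <= (2 * u) ^+ 2 by rewrite ler_sqr ?nnegrE; lra.
  have := sqr_ge0 (u ^+ 2 - 1).
  have -> : a ^+ 2 + b ^+ 2 = (a + b) ^+ 2 - 2 * (a * b) by ring.
  have -> : u ^+ 4 = (u ^+ 2) ^+ 2 by ring.
  rewrite ab; move: ab2; rewrite exprMn; move: (u ^+ 2) => w; nra.
have [m xm] : exists m, 2 * `|x| <= 2 ^+ m.
  exists (Num.truncn (2 * `|x|)).+1.
  have := truncnS_gt (2 * `|x|); move: (Num.truncn _).+1 => n xn.
  rewrite (le_trans (ltW xn)) // -natrX ler_nat ltnW //; exact: ltn_expl.
by apply: (double m); lra.
Qed.

Definition rademacher_sum (R : realType) (k : nat) (x : 'I_k -> R)
    (e : {ffun 'I_k -> bool}) : R := \sum_a (-1) ^+ e a * x a.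

(* Averaging over one sign at a time moves the square x_m^2 out of the sum, at
   the price of a small change of the parameter l. *)
Lemma rademacher_sum_mgf (R : realType) (k : nat) (x : 'I_k -> R) (l : R) :
  `|l| * (\sum_a x a ^+ 2) <= 1 / 40 ->
  \sum_e expR (l * rademacher_sum x e ^+ 2) <=
  2 ^+ k * expR (l * (\sum_a x a ^+ 2) + 8 * (l * \sum_a x a ^+ 2) ^+ 2).
Proof.
move=> lV; set V := \sum_a x a ^+ 2 in lV *.
pose W m := \sum_(a < k | (a < m)%N) x a ^+ 2.
pose S m (e : {ffun 'I_k -> bool}) := \sum_(a < k | (m <= a)%N) (-1) ^+ e a * x a.
have W0 m : 0 <= W m by apply: sumr_ge0 => a _; exact: sqr_ge0.
have WV m : W m <= V.
  rewrite /V (bigID (fun a : 'I_k => (a < m)%N)) /= lerDl.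
  by apply: sumr_ge0 => a _; exact: sqr_ge0.
(* Averaging [expR (mu * (y + s) ^+ 2)] over the sign of [y] adds at most
   [8 * mu ^+ 2 * y ^+ 2 * s ^+ 2] to the exponent, by [cosh_le_expR_sqr]. As
   [mu ^+ 2 <= 2 * l ^+ 2], the coefficient of [s ^+ 2] grows by [16 * l ^+ 2 * y ^+ 2]; the term
   [8 * (l * W m) ^+ 2] absorbs the cross terms that this produces. *)
have step m : (m <= k)%N -> \sum_e expR (l * rademacher_sum x e ^+ 2) <=
    \sum_e expR (l * W m + 8 * (l * W m) ^+ 2 + (l + 16 * l ^+ 2 * W m) * S m e ^+ 2).
  elim: m => [_|m IH mk].
    have W00 : W 0%N = 0 by rewrite /W big_pred0.
    by rewrite ler_sum // => e _; rewrite W00 !(mulr0, expr0n, addr0, add0r).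
  apply: le_trans (IH (ltnW mk)) _; pose a0 := Ordinal mk.
  (* After doubling both sums, each sign vector is paired with its flip at [a0]. *)
  pose flip (e : {ffun 'I_k -> bool}) := [ffun a => (a == a0) (+) e a].
  have flipK : involutive flip.
    by move=> e; apply/ffunP=> a; rewrite !ffunE addKb.
  have SS e : S m e = (-1) ^+ e a0 * x a0 + S m.+1 e.
    rewrite /S (bigD1 a0) //=; congr (_ + _); apply: eq_bigl => a.
    by rewrite -val_eqE /= [RHS]ltn_neqAle andbC eq_sym.
  have Sf e : S m.+1 (flip e) = S m.+1 e.
    apply: eq_bigr => a ma; rewrite ffunE (_ : a == a0 = false) //.
    by rewrite -val_eqE /= gtn_eqF.
  have WS : W m.+1 = W m + x a0 ^+ 2.
    rewrite /W (bigD1 a0) ?ltnSn //= addrC; congr (_ + _); apply: eq_bigl => a.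
    by rewrite -val_eqE /= ltnS [RHS]ltn_neqAle andbC.
  have twice (z : R) : 2 * z = z + z by ring.
  rewrite -(ler_pM2l (_ : 0 < 2)) // [leLHS]twice [leRHS]twice.
  rewrite [X in _ + X <= _](reindex_inj (inv_inj flipK)) -!big_split /=.
  apply: ler_sum => e _; rewrite !SS Sf ffunE eqxx /=.
  have -> : (-1) ^+ (~~ e a0) * x a0 = - ((-1) ^+ e a0 * x a0).
    by rewrite signrN mulNr.
  set s := S m.+1 e; set y := (-1) ^+ e a0 * x a0; set A := l * W m + _.
  have y2 : x a0 ^+ 2 = y ^+ 2 by rewrite /y exprMn sqrr_sign mul1r.
  set mu := l + _.
  have -> : A + mu * (y + s) ^+ 2 = (A + mu * (y ^+ 2 + s ^+ 2)) + 2 * mu * y * s by ring.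
  have -> : A + mu * (- y + s) ^+ 2 = (A + mu * (y ^+ 2 + s ^+ 2)) - 2 * mu * y * s by ring.
  set P := A + _; set q := 2 * mu * y * s.
  rewrite (expRD P q) (expRD P (- q)) -mulrDr.
  apply: le_trans (ler_wpM2l (expR_ge0 _) (cosh_le_expR_sqr _)) _.
  rewrite mulrCA -expRD -mulr2n -[leRHS]mulr_natl ler_pM2l // ler_expR WS y2 /P /q.
  (* The bound 1/40 enters here: [(1 + 16 / 40) ^+ 2] is 1.96, below 2. *)
  have muB : mu ^+ 2 <= 2 * l ^+ 2.
    have -> : mu = l * (1 + 16 * (l * W m)) by rewrite /mu; ring.
    rewrite exprMn mulrC ler_wpM2r ?sqr_ge0 //.
    have : `|l * W m| <= 1 / 40.
      by rewrite normrM (ger0_norm (W0 m)) (le_trans _ lV) // ler_wpM2l.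
    rewrite ler_norml => /andP[]; move: (l * W m) => z z1 z2.
    nra.
  have ys : 0 <= y ^+ 2 * s ^+ 2 by rewrite mulr_ge0 // sqr_ge0.
  have := ler_wpM2r ys muB.
  have : 0 <= (l * y ^+ 2) ^+ 2 by exact: sqr_ge0.
  clear; rewrite /A /mu; move: (W m) y s => w y s; nra.
apply: le_trans (step k (leqnn k)) _.
rewrite (eq_bigr (fun=> expR (l * V + 8 * (l * V) ^+ 2))) => [|e _]; last first.
  have -> : S k e = 0 by rewrite /S big_pred0 // => a; rewrite leqNgt ltn_ord.
  rewrite expr0n mulr0 addr0 (_ : W k = V) //.
  by apply: eq_bigl => a; rewrite ltn_ord.
by rewrite sumr_const card_ffun card_bool card_ord -[leLHS]mulr_natl natrX.
Qed.

(** The columns vary independently, so the sum over [f] is a product of [r] sums over one column. *)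
Lemma rademacher_columns_mgf (R : realType) (k r : nat) (x : 'I_k -> R) (l : R) :
  `|l| * (\sum_a x a ^+ 2) <= 1 / 40 ->
  \sum_(f : {ffun 'I_r -> {ffun 'I_k -> bool}})
    expR (l * \sum_j rademacher_sum x (f j) ^+ 2) <=
  (2 ^+ k) ^+ r *
    expR (r%:R * (l * (\sum_a x a ^+ 2) + 8 * (l * \sum_a x a ^+ 2) ^+ 2)).
Proof.
move=> lV; under eq_bigr => f _ do rewrite mulr_sumr expR_sum.
rewrite -(bigA_distr_bigA (fun=> fun e => expR (l * rademacher_sum x e ^+ 2))).
rewrite prodr_const card_ord expRM_natl -exprMn.
rewrite lerXn2r ?nnegrE ?rademacher_sum_mgf ?mulr_ge0 ?expR_ge0 ?exprn_ge0 //.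
by apply: sumr_ge0 => e _; exact: expR_ge0.
Qed.

(** Chernoff and union bounds in counting form. [cost] adds up, over [t], exponential bounds for
    both tails; its total is less than the number of sign matrices, so some [f] costs less than 1,
    and then no tail event occurs. *)
Lemma rademacher_columns_concentration (R : realType) (k r : nat) (T : finType)
    (x : T -> 'I_k -> R) (eps : R) :
  0 < eps <= 1 -> 2 * #|T|%:R * expR (- (eps ^+ 2 * r%:R / 50)) < 1 ->
  exists f : {ffun 'I_r -> {ffun 'I_k -> bool}}, forall t,
    `|\sum_j rademacher_sum (x t) (f j) ^+ 2 - r%:R * \sum_a x t a ^+ 2| <=
      eps * (r%:R * \sum_a x t a ^+ 2).
Proof.
move=> /andP[e0 e1] small; pose V t := \sum_a x t a ^+ 2.
have V0 t : 0 <= V t by apply: sumr_ge0 => a _; exact: sqr_ge0.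
pose Z t (f : {ffun 'I_r -> {ffun 'I_k -> bool}}) :=
  \sum_j rademacher_sum (x t) (f j) ^+ 2.
(* With [l * V = eps / 40] the moment bound applies, and both exponents become [r * (8 * eps ^+ 2 /
   1600 - eps ^+ 2 / 40)], which is [- (eps ^+ 2 * r / 50)]. *)
pose l t := eps / (40 * V t).
pose up t f := expR (l t * Z t f) * expR (- (l t * (1 + eps) * (r%:R * V t))).
pose down t f := expR (- l t * Z t f) * expR (l t * (1 - eps) * (r%:R * V t)).
pose cost f := \sum_(t | V t != 0) (up t f + down t f).
have lV t : V t != 0 -> l t * V t = eps / 40.
  by move=> Vt; rewrite /l invfM mulrA mulfVK.
have [f fP] : exists f, cost f < 1.
  apply/existsP; apply: contraT; rewrite negb_exists => /forallP noex.
  have : \sum_f cost f < (2 ^+ k) ^+ r.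
    rewrite exchange_big /=.
    apply: (@le_lt_trans _ _ (\sum_(t : T) (2 ^+ k) ^+ r * (2 * expR (- (eps ^+ 2 * r%:R / 50))))).
      rewrite big_mkcond; apply: ler_sum => t _; case: ifPn => [Vt|_]; last first.
        by rewrite !mulr_ge0 ?expR_ge0 ?exprn_ge0.
      rewrite /up /down big_split /= -!mulr_suml.
      have bnd s : `|s| = l t -> \sum_f expR (s * Z t f) <= (2 ^+ k) ^+ r *
          expR (r%:R * (s * V t + 8 * (s * V t) ^+ 2)).
        move=> sl; apply: rademacher_columns_mgf; rewrite sl -/(V t) lV //; lra.
      have l0 : 0 <= l t by rewrite divr_ge0 ?mulr_ge0 // ltW.
      have := bnd (l t) (ger0_norm l0); have := bnd (- l t).
      rewrite normrN ger0_norm // => /(_ erefl) b1 b2.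
      move: b1 b2 (lV _ Vt); move: (l t) (V t) => s w b1 b2 sw.
      apply: le_trans (lerD (ler_wpM2r (expR_ge0 _) b2) (ler_wpM2r (expR_ge0 _) b1)) _.
      rewrite -2!(mulrA (_ ^+ r)) -!expRD -mulrDr ler_wpM2l ?exprn_ge0 //.
      have twice (z : R) : 2 * z = z + z by ring.
      rewrite [leRHS]twice.
      have E1 : r%:R * (s * w + 8 * (s * w) ^+ 2 - (1 + eps) * (s * w)) =
        - (eps ^+ 2 * r%:R / 50) by rewrite sw; field.
      have E2 : r%:R * (- (s * w) + 8 * (s * w) ^+ 2 + (1 - eps) * (s * w)) =
        - (eps ^+ 2 * r%:R / 50) by rewrite sw; field.
      apply: lerD; rewrite ler_expR le_eqVlt; apply/orP; left; apply/eqP.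
        by rewrite -E1; ring.
      by rewrite -E2; ring.
    rewrite sumr_const -[ltLHS]mulr_natl mulrCA -[ltRHS]mulr1 ltr_pM2l ?exprn_gt0 //.
    by rewrite mulrA [_ * 2]mulrC.
  rewrite ltNge => /negP; case.
  apply: (@le_trans _ _ (\sum_(f : {ffun 'I_r -> {ffun 'I_k -> bool}}) 1)).
    by rewrite sumr_const !card_ffun card_bool !card_ord !natrX.
  by apply: ler_sum => f _; rewrite leNgt; exact: noex.
exists f => t; rewrite -/(Z t f) -/(V t).
have [Vt|Vt] := eqVneq (V t) 0.
  have x0 a : x t a = 0.
    apply/eqP; rewrite -sqrf_eq0; move/eqP: Vt; rewrite psumr_eq0 => [|i _]; last exact: sqr_ge0.
    by move=> /allP /(_ a (mem_index_enum _)).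
  rewrite Vt !mulr0 subr0 /Z big1 ?normr0 // => j _.
  by rewrite /rademacher_sum big1 ?expr0n // => a _; rewrite x0 mulr0.
have l0 : 0 < l t by rewrite divr_gt0 // mulr_gt0 // lt_def Vt V0.
have : up t f + down t f < 1.
  apply: le_lt_trans fP; rewrite /cost (bigD1 t) //= lerDl.
  by apply: sumr_ge0 => s _; rewrite addr_ge0 ?mulr_ge0 ?expR_ge0.
have u0 : 0 <= up t f by rewrite mulr_ge0 ?expR_ge0.
have d0 : 0 <= down t f by rewrite mulr_ge0 ?expR_ge0.
move=> ud; have {u0 d0 ud} [] : up t f < 1 /\ down t f < 1 by lra.
rewrite /up /down -!expRD -[1]expR0 !ltr_expR expR0.
move: (Z t f) (r%:R * V t) => z w u d.
have {}u : l t * (z - (1 + eps) * w) < 0 by lra.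
have {}d : l t * ((1 - eps) * w - z) < 0 by lra.
rewrite pmulr_rlt0 // in u; rewrite pmulr_rlt0 // in d.
by rewrite ler_norml; apply/andP; split; lra.
Qed.

(** Lagrange's identity: the difference of the sides is half of a double sum of squares. *)
Lemma cauchy_schwarz_sum (R : realType) (I : finType) (a b : I -> R) :
  (\sum_i a i * b i) ^+ 2 <= (\sum_i a i ^+ 2) * (\sum_i b i ^+ 2).
Proof.
have : 0 <= \sum_i \sum_j (a i * b j - a j * b i) ^+ 2.
  by apply: sumr_ge0 => i _; apply: sumr_ge0 => j _; exact: sqr_ge0.
have prod (f g : I -> R) : (\sum_i f i) * (\sum_i g i) = \sum_i \sum_j f i * g j.
  by rewrite mulr_suml; apply: eq_bigr => i _; rewrite mulr_sumr.
suff -> : \sum_i \sum_j (a i * b j - a j * b i) ^+ 2 =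
    2 * ((\sum_i a i ^+ 2) * (\sum_i b i ^+ 2) - (\sum_i a i * b i) ^+ 2) by lra.
have E : (\sum_i a i ^+ 2) * (\sum_i b i ^+ 2) = (\sum_i b i ^+ 2) * (\sum_i a i ^+ 2).
  exact: mulrC.
rewrite [2 * _]mulrC mulr_natr mulr2n {2}E expr2 !prod -!sumrB -!big_split /=.
apply: eq_bigr => i _; rewrite -!sumrB -!big_split /=.
by apply: eq_bigr => j _; ring.
Qed.

Definition dot (R : realType) (k : nat) (x y : 'cV[R]_k) : R :=
  \sum_a x a 0 * y a 0.

Lemma dotxx (R : realType) (k : nat) (x : 'cV[R]_k) :
  dot x x = \sum_a x a 0 ^+ 2.
Proof. by apply: eq_bigr => a _; rewrite expr2. Qed.

Lemma dotxx_ge0 (R : realType) (k : nat) (x : 'cV[R]_k) : 0 <= dot x x.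
Proof. by rewrite dotxx; apply: sumr_ge0 => a _; exact: sqr_ge0. Qed.

Lemma dotxx_eq0 (R : realType) (k : nat) (x : 'cV[R]_k) : dot x x = 0 -> x = 0.
Proof.
rewrite dotxx => /eqP; rewrite psumr_eq0 => [/allP x0|a _]; last exact: sqr_ge0.
apply/colP=> a; rewrite mxE; apply/eqP; rewrite -sqrf_eq0.
exact: x0 (mem_index_enum _).
Qed.

(** Concentration is applied to [x] and to the two vectors [|y| x + |x| y] and [|y| x - |x| y], from
    which polarization recovers [<y, Q x>]. Three vectors with two tails each make the 6. *)
Lemma rademacher_projection (R : realType) (k r : nat) (T : finType)
    (x y : T -> 'cV[R]_k) (eps : R) :
  0 < eps <= 1 -> (0 < r)%N ->
  6 * #|T|%:R * expR (- (eps ^+ 2 * r%:R / 50)) < 1 ->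
  exists Q : 'M[R]_k,
    [/\ (\rank Q <= r)%N,
        forall z a, (Q *m z) a 0 ^+ 2 <= dot z (Q *m z),
        forall t, dot (x t) (Q *m x t) <= (1 + eps) * dot (x t) (x t)
      & forall t, `|dot (y t) (Q *m x t) - dot (y t) (x t)| <=
          eps * (Num.sqrt (dot (x t) (x t)) * Num.sqrt (dot (y t) (y t)))].
Proof.
move=> e01 r0 small; have /andP[e0 e1] := e01.
pose al t := Num.sqrt (dot (x t) (x t)); pose be t := Num.sqrt (dot (y t) (y t)).
pose v (p : T * option bool) (a : 'I_k) : R := match p.2 with
  | None => x p.1 a 0
  | Some b => be p.1 * x p.1 a 0 + (-1) ^+ b * (al p.1 * y p.1 a 0)
  end.
have {small} small : 2 * #|{: T * option bool}|%:R * expR (- (eps ^+ 2 * r%:R / 50)) < 1.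
  rewrite card_prod card_option card_bool natrM.
  by have -> : 2 * (#|T|%:R * 3) = 6 * #|T|%:R :> R by ring.
have [f fP] := rademacher_columns_concentration v e01 small.
pose X : 'M[R]_(k, r) := \matrix_(a, j) (-1) ^+ f j a.
pose rad (z : 'cV[R]_k) j := rademacher_sum (fun a => z a 0) (f j).
have XE z j : (X^T *m z) j 0 = rad z j.
  by rewrite mxE; apply: eq_bigr => a _; rewrite !mxE.
have rr : (r%:R : R) != 0 by rewrite pnatr_eq0 -lt0n.
have rr0 : 0 < (r%:R : R) by rewrite ltr0n.
pose Q := (r%:R^-1 : R) *: (X *m X^T).
have QE w z : dot w (Q *m z) = r%:R^-1 * \sum_j rad w j * rad z j.
  rewrite /dot /Q -scalemxAl.
  under eq_bigr => a _ do rewrite mxE mulrCA -mulmxA mxE mulr_sumr.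
  rewrite -mulr_sumr exchange_big /=; congr (_ * _); apply: eq_bigr => j _.
  rewrite -XE [(X^T *m w) j 0]mxE XE mulr_suml; apply: eq_bigr => a _.
  by rewrite !mxE /=; ring.
exists Q; split.
- rewrite (leq_trans (mxrank_scale _ _)) // (leq_trans (mxrankM_maxl _ _)) //.
  exact: rank_leq_col.
(* A row of [X] consists of [r] signs, so Cauchy-Schwarz between it and [X^T *m z] bounds the
   squared entry by [|X^T z|^2 / r], which is [<z, Q z>]. *)
- move=> z a; rewrite QE -scalemxAl mxE -mulmxA mxE.
  under eq_bigr => j _ do rewrite XE mxE.
  rewrite exprMn; apply: le_trans (ler_wpM2l (sqr_ge0 _) (cauchy_schwarz_sum _ _)) _.
  rewrite (eq_bigr (fun=> 1)) => [|j _]; last by rewrite sqrr_sign.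
  rewrite sumr_const card_ord mulrA [r%:R^-1 ^+ 2]expr2 mulfVK //.
- move=> t; have := fP (t, None); rewrite QE /v /= dotxx.
  rewrite -[\sum_j rademacher_sum _ _ ^+ 2]/(\sum_j rad (x t) j ^+ 2).
  under [\sum_j rad _ _ * _]eq_bigr => j _ do rewrite -expr2.
  rewrite ler_norml => /andP[_ ub]; rewrite mulrC ler_pdivrMr //.
  lra.
move=> t; rewrite QE -/(al t) -/(be t).
have al0 : 0 <= al t by exact: sqrtr_ge0.
have be0 : 0 <= be t by exact: sqrtr_ge0.
have al2 : al t ^+ 2 = dot (x t) (x t) by rewrite sqr_sqrtr ?dotxx_ge0.
have be2 : be t ^+ 2 = dot (y t) (y t) by rewrite sqr_sqrtr ?dotxx_ge0.
have zero : x t = 0 \/ y t = 0 -> \sum_j rad (y t) j * rad (x t) j = 0 /\ dot (y t) (x t) = 0.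
  have rad0 j : rad 0 j = 0.
    by rewrite /rad /rademacher_sum big1 // => a _; rewrite mxE mulr0.
  case=> ->; (split; [rewrite big1 // => j _|rewrite /dot big1 // => a _]);
   by rewrite ?rad0 ?mxE ?mulr0 ?mul0r.
(* Polarization divides by [|x| |y|]; if one norm vanishes, both pairings are 0. *)
have [a0|a0] := eqVneq (al t) 0.
  have [] := zero (or_introl (dotxx_eq0 _)); first by rewrite -al2 a0 expr0n.
  by move=> -> ->; rewrite mulr0 subr0 normr0 !mulr_ge0 // ltW.
have [b0|b0] := eqVneq (be t) 0.
  have [] := zero (or_intror (dotxx_eq0 _)); first by rewrite -be2 b0 expr0n.
  by move=> -> ->; rewrite mulr0 subr0 normr0 !mulr_ge0 // ltW.
have ap : 0 < al t by rewrite lt_def a0.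
have bp : 0 < be t by rewrite lt_def b0.
have radv b j : rademacher_sum (v (t, Some b)) (f j) =
    be t * rad (x t) j + (-1) ^+ b * (al t * rad (y t) j).
  rewrite /rad /rademacher_sum !mulr_sumr -big_split /=; apply: eq_bigr => a _.
  by rewrite /v /=; ring.
pose xx := \sum_j rad (x t) j ^+ 2; pose yy := \sum_j rad (y t) j ^+ 2.
pose xy := \sum_j rad (y t) j * rad (x t) j.
have sumv b : \sum_j rademacher_sum (v (t, Some b)) (f j) ^+ 2 =
    be t ^+ 2 * xx + al t ^+ 2 * yy + (-1) ^+ b * (2 * (al t * be t)) * xy.
  rewrite /xx /yy /xy !mulr_sumr -!big_split /=; apply: eq_bigr => j _.
  rewrite radv sqrrD [X in _ + X]exprMn sqrr_sign; ring.
have normv b : \sum_a v (t, Some b) a ^+ 2 =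
    2 * (al t * be t) ^+ 2 + (-1) ^+ b * (2 * (al t * be t)) * dot (y t) (x t).
  transitivity (be t ^+ 2 * dot (x t) (x t) + al t ^+ 2 * dot (y t) (y t) +
     (-1) ^+ b * (2 * (al t * be t)) * dot (y t) (x t)).
    rewrite !dotxx /dot !mulr_sumr -!big_split /=; apply: eq_bigr => a _.
    rewrite /v /= sqrrD [X in _ + X]exprMn sqrr_sign; ring.
  by rewrite -al2 -be2; ring.
have := fP (t, Some false); have := fP (t, Some true).
rewrite !sumv !normv expr0 expr1 !mul1r.
move: ap bp {sumv normv radv zero}; rewrite -/xy.
move: (dot (y t) (x t)) xy xx yy => D xy xx yy.
move: (al t) (be t) {al0 be0 al2 be2 a0 b0} => p q p0 q0.
rewrite !ler_norml => /andP[m1 m2] /andP[p1 p2].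
have pq : 0 < p * q by exact: mulr_gt0.
(* Subtracting the estimates for the two signs cancels [xx] and [yy], while the errors add up to
   [4 * eps * r * (p * q) ^+ 2]. *)
have U : (p * q) * xy - (p * q) * (r%:R * D) <= (p * q) * (eps * (r%:R * (p * q))) by lra.
have L : - ((p * q) * (eps * (r%:R * (p * q)))) <= (p * q) * xy - (p * q) * (r%:R * D) by lra.
rewrite -mulrBr ler_pM2l // in U.
rewrite -mulrBr -mulrN ler_pM2l // in L.
have -> : r%:R^-1 * xy - D = (xy - r%:R * D) / r%:R by field.
rewrite ler_pdivrMr // ler_pdivlMr //; apply/andP; split; lra.
Qed.

(** * Compressing a CP representation *)

(** Modes are numbered by [nat] and [c s] takes a whole index, of which it will read one mode only;
    this keeps the recursion free of dependent types. *)
Fixpoint chain (R : realType) (k : nat) (I : Type) (c : nat -> I -> 'cV[R]_k)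
    (Q : nat -> 'M[R]_k) (t : nat) (i : I) : 'cV[R]_k :=
  if t is u.+1 then \col_a (c t i a 0 * (Q u *m chain c Q u i) a 0) else c 0%N i.

Definition tail (R : realType) (k : nat) (I : Type) (c : nat -> I -> 'cV[R]_k)
    (d t : nat) (i : I) : 'cV[R]_k := \col_a \prod_(t <= s < d) c s i a 0.

Lemma tailS (R : realType) (k : nat) (I : Type) (c : nat -> I -> 'cV[R]_k)
    (d t : nat) (i : I) (a : 'I_k) : (t < d)%N ->
  tail c d t i a 0 = c t i a 0 * tail c d t.+1 i a 0.
Proof. by move=> td; rewrite !mxE big_ltn. Qed.

(** Mode [t] is measured in Euclidean norm and the later modes entrywise, an entry being at most the
    norm. *)
Lemma dot_tail_le (R : realType) (k : nat) (I : Type) (c : nat -> I -> 'cV[R]_k)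
    (m : nat -> R) (d t : nat) (i : I) :
  (forall s, 0 <= m s) -> (forall s, dot (c s i) (c s i) <= m s ^+ 2) ->
  (t < d)%N ->
  dot (tail c d t i) (tail c d t i) <= (\prod_(t <= s < d) m s) ^+ 2.
Proof.
move=> m0 cm td.
have cma s a : `|c s i a 0| <= m s.
  rewrite -ler_sqr ?nnegrE // real_normK ?num_real // (le_trans _ (cm s)) //.
  by rewrite dotxx (bigD1 a) //= lerDl sumr_ge0 // => b _; exact: sqr_ge0.
have tm a : tail c d t.+1 i a 0 ^+ 2 <= (\prod_(t.+1 <= s < d) m s) ^+ 2.
  rewrite -real_normK ?num_real // ler_sqr ?nnegrE ?prodr_ge0 // mxE normr_prod.
  by apply: ler_prod => s _; rewrite normr_ge0 cma.
rewrite [leRHS](_ : _ = m t ^+ 2 * (\prod_(t.+1 <= s < d) m s) ^+ 2); last first.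
  by rewrite -exprMn [in LHS]big_ltn.
rewrite dotxx; apply: (@le_trans _ _ (dot (c t i) (c t i) * (\prod_(t.+1 <= s < d) m s) ^+ 2)).
  rewrite dotxx mulr_suml; apply: ler_sum => a _.
  by rewrite tailS // exprMn ler_wpM2l ?sqr_ge0.
by rewrite ler_wpM2r ?sqr_ge0.
Qed.

(** Cauchy-Schwarz between mode 0 and the tail, hence at least two modes. *)
Lemma norm_sum_prod_le (R : realType) (k : nat) (I : Type)
    (c : nat -> I -> 'cV[R]_k) (m : nat -> R) (d : nat) (i : I) :
  (1 < d)%N -> (forall s, 0 <= m s) ->
  (forall s, dot (c s i) (c s i) <= m s ^+ 2) ->
  `|\sum_a tail c d 0 i a 0| <= \prod_(0 <= s < d) m s.
Proof.
move=> d1 m0 cm.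
rewrite -ler_sqr ?nnegrE ?prodr_ge0 // real_normK ?num_real //.
rewrite (eq_bigr (fun a => c 0%N i a 0 * tail c d 1 i a 0)) => [|a _]; last first.
  by rewrite tailS // ltnW.
apply: le_trans (cauchy_schwarz_sum _ _) _; rewrite -!dotxx.
rewrite [X in _ <= X ^+ 2]big_ltn ?(ltnW d1) // exprMn.
by apply: ler_pM; rewrite ?dotxx_ge0 ?dot_tail_le.
Qed.

(* At step t the vectors to be compressed are known once the earlier projections
   have been chosen, so each projection is drawn after the previous ones. *)
Lemma chain_approximation (R : realType) (k r d : nat) (I : finType)
    (c : nat -> I -> 'cV[R]_k) (m : nat -> R) (eps : R) :
  (forall s, 0 <= m s) -> (forall s i, dot (c s i) (c s i) <= m s ^+ 2) ->
  0 < eps <= 1 -> (0 < r)%N ->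
  6 * #|I|%:R * expR (- (eps ^+ 2 * r%:R / 50)) < 1 ->
  exists Q : nat -> 'M[R]_k, (forall t, (\rank (Q t) <= r)%N) /\
    forall i, `|\sum_a chain c Q d i a 0 - \sum_a tail c d.+1 0 i a 0| <=
      eps * 2 ^+ d * \prod_(0 <= s < d.+1) m s.
Proof.
move=> m0 cm e01 r0 small; have /andP[e0 e1] := e01.
have [F FP] := choice (fun p : nat * (I -> 'cV[R]_k) =>
  rademacher_projection p.2 (fun i => tail c d.+1 p.1.+1 i) e01 r0 small).
pose L := fix L t : I -> 'cV[R]_k := fun i =>
  if t is u.+1 then \col_a (c t i a 0 * (F (u, L u) *m L u i) a 0) else c 0%N i.
pose Q t := F (t, L t).
have LE t i : chain c Q t i = L t i by elim: t i => //= t IH i; rewrite IH.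
have LS t i a : L t.+1 i a 0 = c t.+1 i a 0 * (Q t *m L t i) a 0 by rewrite mxE.
have rQ t : (\rank (Q t) <= r)%N by have [] := FP (t, L t).
have Qsup t z a : (Q t *m z) a 0 ^+ 2 <= dot z (Q t *m z).
  by have [_ + _ _] := FP (t, L t); exact.
have Qnorm t i : dot (L t i) (Q t *m L t i) <= (1 + eps) * dot (L t i) (L t i).
  by have [_ _ + _] := FP (t, L t); exact.
have Qdot t i : `|dot (tail c d.+1 t.+1 i) (Q t *m L t i) -
    dot (tail c d.+1 t.+1 i) (L t i)| <= eps *
    (Num.sqrt (dot (L t i) (L t i)) *
     Num.sqrt (dot (tail c d.+1 t.+1 i) (tail c d.+1 t.+1 i))).
  by have [_ _ _] := FP (t, L t); exact.
exists Q; split=> // i; rewrite LE.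
set P := \prod_(0 <= s < d.+1) m s.
have P0 n1 n2 : 0 <= \prod_(n1 <= s < n2) m s by exact: prodr_ge0.
have Lnorm t : dot (L t i) (L t i) <= (2 ^+ t * \prod_(0 <= s < t.+1) m s) ^+ 2.
  elim: t => [|t IH]; first by rewrite expr0 mul1r big_nat1; exact: cm.
  rewrite big_nat_recr //=; set p := \prod_(0 <= s < t.+1) m s in IH *.
  apply: (@le_trans _ _ (dot (c t.+1 i) (c t.+1 i) * dot (L t i) (Q t *m L t i))).
    rewrite [X in X <= _]dotxx dotxx mulr_suml; apply: ler_sum => a _.
    by rewrite LS exprMn ler_wpM2l ?sqr_ge0.
  apply: (@le_trans _ _ (m t.+1 ^+ 2 * (2 * (2 ^+ t * p) ^+ 2))).
    apply: ler_pM; rewrite ?dotxx_ge0 ?cm //.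
      case: (posnP k) => [k0|k0]; last exact: le_trans (sqr_ge0 _) (Qsup t _ (Ordinal k0)).
      by rewrite /dot big1 // => -[a ak]; exfalso; rewrite k0 in ak.
    apply: le_trans (Qnorm t i) _; apply: ler_pM; rewrite ?dotxx_ge0 //; lra.
  (* The step costs a factor 2 in the squared norm; allowing 4 keeps the bound a square without
     roots of 2. *)
  have -> : (2 ^+ t.+1 * (p * m t.+1)) ^+ 2 = m t.+1 ^+ 2 * (4 * (2 ^+ t * p) ^+ 2).
    by rewrite (exprS 2 t); ring.
  by rewrite ler_wpM2l ?sqr_ge0 // ler_wpM2r ?sqr_ge0 // ler_nat.
(* [E t] is the hybrid with only the first [t] projections inserted: exact at 0, fully compressed at
   [d]. The step errors sum to at most [(2 ^+ d - 1) * (eps * P)]. *)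
pose E t := dot (tail c d.+1 t.+1 i) (L t i).
have E0 : E 0%N = \sum_a tail c d.+1 0 i a 0.
  by apply: eq_bigr => a _; rewrite [RHS]tailS // mulrC.
have Ed : E d = \sum_a L d i a 0.
  by apply: eq_bigr => a _; rewrite mxE big_geq // mul1r.
have Estep t : (t < d)%N -> `|E t.+1 - E t| <= eps * (2 ^+ t * P).
  move=> td; have -> : E t.+1 = dot (tail c d.+1 t.+1 i) (Q t *m L t i).
    by apply: eq_bigr => a _; rewrite LS [in RHS]tailS // mulrA [_ * c _ _ _ _]mulrC.
  apply: le_trans (Qdot t i) _; apply: ler_wpM2l; first exact: ltW.
  rewrite /P (big_cat_nat _ (n := t.+1)) //=; last exact: ltnW.
  rewrite mulrA; apply: ler_pM; rewrite ?sqrtr_ge0 //.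
    apply: le_trans (ler_wsqrtr (Lnorm t)) _.
    by rewrite sqrtr_sqr ger0_norm // mulr_ge0 // exprn_ge0.
  apply: le_trans (ler_wsqrtr (dot_tail_le m0 (fun s => cm s i) _)) _ => //.
  by rewrite sqrtr_sqr ger0_norm.
have {Estep} Ebnd t : (t <= d)%N -> `|E t - E 0%N| <= eps * 2 ^+ t * P.
  elim: t => [_|t IH td].
    by rewrite subrr normr0 expr0 mulr1 mulr_ge0 // ?P0 // ltW.
  rewrite -(subrKA (E t)); apply: le_trans (ler_normD _ _) _.
  have := Estep t td; have := IH (ltnW td); rewrite (exprS 2 t); lra.
by rewrite -Ed -E0; exact: Ebnd.
Qed.

Lemma chain_ext (R : realType) (k : nat) (I : Type) (c : nat -> I -> 'cV[R]_k)
    (Q : nat -> 'M[R]_k) (t : nat) (i j : I) :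
  (forall s, (s <= t)%N -> c s i = c s j) -> chain c Q t i = chain c Q t j.
Proof.
elim: t => [|t IH] cij /=; first exact: cij.
by rewrite cij // IH // => s st; apply: cij; exact: leqW.
Qed.

(** A Hadamard product with a fixed vector is a diagonal matrix, so the chain beyond [t] is linear
    in the chain at [t] and passes through [Q t]. *)
Lemma chain_factor (R : realType) (k : nat) (I : Type) (c : nat -> I -> 'cV[R]_k)
    (Q : nat -> 'M[R]_k) (t u : nat) : (t < u)%N ->
  exists H : I -> 'M[R]_k,
    (forall i j, (forall s, (t < s <= u)%N -> c s i = c s j) -> H i = H j) /\
    forall i, chain c Q u i = H i *m Q t *m chain c Q t i.
Proof.
have colE (x z : 'cV[R]_k) : \col_a (x a 0 * z a 0) = diag_mx x^T *m z.
  by apply/colP=> a; rewrite mul_diag_mx !mxE.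
elim: u => // u IH; rewrite ltnS leq_eqVlt => /predU1P[<-|tu].
  exists (fun i => diag_mx (c t.+1 i)^T); split=> [i j cij|i].
    by rewrite cij // !leqnn.
  by rewrite /= colE mulmxA.
have [H [Hext HE]] := IH tu.
exists (fun i => diag_mx (c u.+1 i)^T *m Q u *m H i); split=> [i j cij|i].
  rewrite cij ?leqnn ?andbT; last exact: leqW.
  by rewrite (Hext i j) // => s /andP[ts su]; apply: cij; rewrite ts leqW.
by rewrite /= colE HE !mulmxA.
Qed.

(** Bond [t.+1] lies just after mode [t], where [Q t] is inserted: the entry at row [i] and column
    [j] is the sum of the entries of [H j *m Q t *m chain c' Q t i]. The column index stands on the
    left, whence the transpose. At the end bonds the rank is at most 1. *)
Lemma rank_unfolding_chain (R : realType) (k r d : nat) (n : 'I_d.+1 -> nat)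
    (B : tensor R n) (c : forall s : 'I_d.+1, 'I_(n s) -> 'cV[R]_k)
    (Q : nat -> 'M[R]_k) (t : 'I_d.+2) :
  (0 < r)%N -> (forall u, (\rank (Q u) <= r)%N) ->
  (forall i, B i =
     \sum_a chain (fun u (i : multi_index n) => c (inord u) (i (inord u))) Q d i a 0) ->
  (\rank (unfolding B t) <= r)%N.
Proof.
move=> r0 rQ BE; pose c' u (i : multi_index n) := c (inord u) (i (inord u)).
have {}BE i : B i = \sum_a chain c' Q d i a 0 by exact: BE.
have c'E u (i j : multi_index n) : i (inord u) = j (inord u) -> c' u i = c' u j.
  by rewrite /c' => ->.
case: t => -[|t] td; rewrite /=; first exact: leq_trans (rank_unfolding_first B) r0.
have [td'|dt] := ltnP t d; last first.
  have -> : t = d by apply/eqP; rewrite eqn_leq dt andbT -2!ltnS.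
  exact: leq_trans (rank_unfolding_last B) r0.
have [H [Hext HE]] := chain_factor c' Q td'.
pose X : 'M[R]_(_, k) := \matrix_(q < #|{: multi_index n}|, a < k)
  (const_mx 1 *m H (enum_val q)) (0 : 'I_1) a.
pose Y : 'M[R]_(k, _) := \matrix_(a < k, p < #|{: multi_index n}|)
  chain c' Q t (enum_val p) a 0.
suff -> : unfolding B t.+1 = (X *m Q t *m Y)^T.
  rewrite mxrank_tr (leq_trans (mxrankM_maxl _ _)) //.
  by rewrite (leq_trans (mxrankM_maxr _ _)).
apply/matrixP=> p q; rewrite [LHS]mxE [RHS]mxE BE.
set i := enum_val p; set j := enum_val q; set g := glue _ _ _.
transitivity ((const_mx 1 *m H j *m Q t *m chain c' Q t i : 'M[R]_1) 0 0).
  have <- : H g = H j.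
    apply: Hext => s /andP[ts sd]; apply: c'E.
    by rewrite glueE inordK // ltnNge ts.
  have <- : chain c' Q t g = chain c' Q t i.
    apply: chain_ext => s st; apply: c'E.
    by rewrite glueE inordK ltnS // (leq_trans st) // ltnW.
  rewrite -!mulmxA (mulmxA (H g)) -HE mxE.
  by apply: eq_bigr => a _; rewrite mxE mul1r.
rewrite !mxE; apply: eq_bigr => b _; rewrite [Y _ _]mxE; congr (_ * _).
by rewrite !mxE; apply: eq_bigr => a _; rewrite [X _ _]mxE.
Qed.

(** * CP factors and the CP quasinorm *)

Lemma norm2inf_ge0 (R : realType) (m k : nat) (C : 'M[R]_(m, k)) :
  0 <= norm2inf C.
Proof. exact: bigmax_ge_id. Qed.

Lemma sum_sqr_row_le (R : realType) (m k : nat) (C : 'M[R]_(m, k)) (i : 'I_m) :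
  \sum_j C i j ^+ 2 <= norm2inf C ^+ 2.
Proof.
have S0 : 0 <= \sum_j C i j ^+ 2 by apply: sumr_ge0 => j _; exact: sqr_ge0.
rewrite -[X in X <= _]sqr_sqrtr // ler_sqr ?nnegrE ?sqrtr_ge0 ?norm2inf_ge0 //.
exact: (le_bigmax _ (fun i => Num.sqrt (\sum_j C i j ^+ 2))).
Qed.

Definition cp_column (R : realType) (d k : nat) (n : 'I_d.+1 -> nat)
    (C : forall s : 'I_d.+1, 'M[R]_(n s, k)) (s : 'I_d.+1) (x : 'I_(n s)) :
  'cV[R]_k := \col_a C s x a.

Lemma dot_cp_column_le (R : realType) (d k : nat) (n : 'I_d.+1 -> nat)
    (C : forall s : 'I_d.+1, 'M[R]_(n s, k)) (s : 'I_d.+1) (x : 'I_(n s)) :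
  dot (cp_column C x) (cp_column C x) <= norm2inf (C s) ^+ 2.
Proof.
by rewrite dotxx; under eq_bigr => a _ do rewrite mxE; exact: sum_sqr_row_le.
Qed.

Lemma cp_tailE (R : realType) (d k : nat) (n : 'I_d.+1 -> nat)
    (C : forall s : 'I_d.+1, 'M[R]_(n s, k)) (A : tensor R n)
    (i : multi_index n) : cp_represents C A ->
  A i = \sum_a tail (fun u (i : multi_index n) => cp_column C (i (inord u)))
    d.+1 0 i a 0.
Proof.
move=> ->; apply: eq_bigr => a _; rewrite mxE big_mkord; apply: eq_bigr => s _.
by rewrite mxE inord_val.
Qed.

Lemma prod_norm2infE (R : realType) (d k : nat) (n : 'I_d.+1 -> nat)
    (C : forall s : 'I_d.+1, 'M[R]_(n s, k)) :
  \prod_(0 <= u < d.+1) norm2inf (C (inord u)) = \prod_(s < d.+1) norm2inf (C s).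
Proof. by rewrite big_mkord; apply: eq_bigr => s _; rewrite inord_val. Qed.

(** Serves to show that a tensor of quasinorm 0 vanishes. *)
Lemma cp_entry_le (R : realType) (d k : nat) (n : 'I_d.+1 -> nat)
    (C : forall s : 'I_d.+1, 'M[R]_(n s, k)) (A : tensor R n)
    (i : multi_index n) : (0 < d)%N -> cp_represents C A ->
  `|A i| <= \prod_(s < d.+1) norm2inf (C s).
Proof.
move=> d0 CA; rewrite (cp_tailE _ CA) -prod_norm2infE.
by apply: norm_sum_prod_le => // u; [exact: norm2inf_ge0|exact: dot_cp_column_le].
Qed.

Lemma cp_approximation (R : realType) (d k r : nat) (n : 'I_d.+1 -> nat)
    (C : forall s : 'I_d.+1, 'M[R]_(n s, k)) (A : tensor R n) (eps : R) :
  cp_represents C A -> 0 < eps <= 1 -> (0 < r)%N ->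
  6 * #|{: multi_index n}|%:R * expR (- (eps ^+ 2 * r%:R / 50)) < 1 ->
  exists B : tensor R n,
    (forall t : 'I_d.+2, (\rank (unfolding B t) <= r)%N) /\
    forall i, `|A i - B i| <= eps * 2 ^+ d * \prod_(s < d.+1) norm2inf (C s).
Proof.
move=> CA e01 r0 small.
pose c u (i : multi_index n) := cp_column C (i (inord u)).
have [Q [rQ QB]] := chain_approximation (m := fun u => norm2inf (C (inord u)))
  (c := c) d (fun u => norm2inf_ge0 _) (fun u i => dot_cp_column_le _ _) e01 r0 small.
exists [ffun i => \sum_a chain c Q d i a 0]; split=> [t|i].
  apply: (rank_unfolding_chain (c := cp_column C) t r0 rQ) => i.
  by rewrite ffunE.
by rewrite ffunE distrC (cp_tailE _ CA) -prod_norm2infE; exact: QB.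
Qed.

Definition cp_costs (R : realType) (d : nat) (n : 'I_d -> nat) (A : tensor R n) :
    set R :=
  [set x | exists (k : nat) (C : forall s : 'I_d, 'M[R]_(n s, k)),
    [/\ (0 < k)%N, cp_represents C A & x = \prod_(s < d) norm2inf (C s)]]%classic.

(** One term per multi-index, a product of unit vectors with the value of [A] placed on mode 0. *)
Lemma cp_costs_nonempty (R : realType) (d : nat) (n : 'I_d.+1 -> nat)
    (A : tensor R n) : (forall s, 0 < n s)%N -> (cp_costs A !=set0)%classic.
Proof.
move=> n0; pose i0 : multi_index n := finfun (fun s => Ordinal (n0 s)).
pose C s : 'M[R]_(n s, #|{: multi_index n}|) := \matrix_(x, p)
  (((enum_val p : multi_index n) s == x)%:R * (if s == ord0 then A (enum_val p) else 1)).
exists (\prod_(s < d.+1) norm2inf (C s)), #|{: multi_index n}|, C; split=> //.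
  by apply/card_gt0P; exists i0.
move=> i; rewrite (bigD1 (enum_rank i)) //= [X in _ + X]big1 => [|p pi]; last first.
  have [s ps] : exists s, (enum_val p : multi_index n) s != i s.
    apply/existsP; apply: contraT; rewrite negb_exists => /forallP E.
    case/eqP: pi; rewrite -[p]enum_valK; congr enum_rank; apply/ffunP=> s.
    by apply/eqP; move: (E s); rewrite negbK.
  by rewrite (bigD1 s) //= mxE (negPf ps) !mul0r.
rewrite addr0 (bigD1 ord0) //= mxE enum_rankK !eqxx mul1r big1 ?mulr1 // => s s0.
by rewrite mxE enum_rankK eqxx (negPf s0) mulr1.
Qed.

Lemma gammaCP_ge0 (R : realType) (d : nat) (n : 'I_d.+1 -> nat)
    (A : tensor R n) : (forall s, 0 < n s)%N -> 0 <= gammaCP A.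
Proof.
move=> n0; apply: lb_le_inf (cp_costs_nonempty A n0) _.
by move=> x [k [C [_ _ ->]]]; apply: prodr_ge0 => s _; exact: norm2inf_ge0.
Qed.

Lemma gammaCP_lt (R : realType) (d : nat) (n : 'I_d.+1 -> nat)
    (A : tensor R n) (x : R) : (forall s, 0 < n s)%N -> gammaCP A < x ->
  exists (k : nat) (C : forall s : 'I_d.+1, 'M[R]_(n s, k)),
    cp_represents C A /\ \prod_(s < d.+1) norm2inf (C s) < x.
Proof.
move=> n0 /(inf_lt (cp_costs_nonempty A n0)) [y [k [C [_ CA ->]]] yx].
by exists k, C.
Qed.

(** * The choice of the rank *)

Lemma expR1_ge2 (R : realType) : 2 <= expR 1 :> R.
Proof. exact: expR_ge1Dx. Qed.

(** The left side is at most [6 * N / (2 * e * N) ^+ 2], that is [3 / (2 * e ^+ 2 * N)], and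
    [e >= 2]. *)
Lemma union_bound_lt1 (R : realType) (N y : R) :
  1 <= N -> 2 * ln (2 * expR 1 * N) <= y -> 6 * N * expR (- y) < 1.
Proof.
move=> N1 Ny; have e2 := expR1_ge2 R.
have N0 : 0 < N by lra.
have p0 : 0 < 2 * expR 1 * N by rewrite !mulr_gt0 // expR_gt0.
apply: (@le_lt_trans _ _ (6 * N * ((2 * expR 1 * N) ^+ 2)^-1)).
  rewrite ler_wpM2l //; first by rewrite mulr_ge0 // ltW.
  rewrite expRN lef_pV2 ?posrE ?expR_gt0 ?exprn_gt0 //.
  by rewrite -{1}(lnK p0) -expRM_natr ler_expR mulrC.
rewrite ltr_pdivrMr ?exprn_gt0 // mul1r !exprMn.
move: (expR 1) e2 => e e2.
have : 4 * N <= e ^+ 2 * N ^+ 2 by apply: ler_pM; nra.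
lra.
Qed.

Theorem corollary1p8 (R : realType) (d : nat) (hd : (2 <= d)%N) :
  exists c : R, 0 < c /\
    forall (eps : R) (n : 'I_d -> nat),
      0 < eps < 1 -> (forall s, (0 < n s)%N) ->
      let r : int :=
        Num.ceil (c / eps ^+ 2 *
                  ln (2 * expR 1 * (\prod_(s < d) n s)%N%:R)) in
      forall A : tensor R n,
        exists (B : tensor R n) (rk : 'I_d.+1 -> nat),
          [/\ is_tt_rank B rk,
              forall t, (rk t)%:Z <= r
            & max_norm (A - B) <= eps * gammaCP A].
Proof.
(* From here on there are [d.+1] modes. With [h = 2 ^+ d.+1] the constant is [50 * 2 * h ^+ 2]: 50
   from concentration, 2 from [union_bound_lt1], and [h ^+ 2] from working at accuracy [eps / h],
   which pays for the loss [2 ^+ d] along the chain and a factor 2 for a nearly optimal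
   representation. *)
case: d hd => // d d1; exists (100 * (2 ^+ d.+1) ^+ 2); split.
  by rewrite mulr_gt0 // !exprn_gt0.
move=> eps n /andP[e0 e1] n0 r A.
have N1 : 1 <= (\prod_(s < d.+1) n s)%N%:R :> R by rewrite ler1n prodn_gt0.
pose lg : R := ln (2 * expR 1 * (\prod_(s < d.+1) n s)%N%:R).
have lg0 : 0 < lg.
  by rewrite ln_gt0 //; have := expR1_ge2 R; move: N1; nra.
have r0 : 0 < r.
  by rewrite ceil_gt0 !mulr_gt0 ?invr_gt0 ?exprn_gt0.
have rE : r = `|r|%N :> int by rewrite gez0_abs // ltW.
have g0 : 0 <= gammaCP A by exact: gammaCP_ge0.
suff [B [rB AB]] : exists B : tensor R n,
    (forall t : 'I_d.+2, (\rank (unfolding B t) <= `|r|)%N) /\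
    forall i, `|A i - B i| <= eps * gammaCP A.
  exists B, (fun t => maxn 1 (\rank (unfolding B t))); split.
  - exact: is_tt_rank_unfolding.
  - by move=> t; rewrite rE lez_nat geq_max rB andbT absz_gt0 gt_eqF.
  - apply: bigmax_le => [|i _]; first by rewrite mulr_ge0 // ltW.
    by rewrite !ffunE AB.
(* If the quasinorm is 0, doubling it leaves no room for a representation, but then [A] is 0 and
   approximates itself. *)
have [gp|gn] := ltrP 0 (gammaCP A); last first.
  have gA : gammaCP A = 0 by apply/eqP; rewrite eq_le gn g0.
  have A0 i : A i = 0.
    apply/eqP; rewrite -normr_le0; apply/ler_addgt0Pr => x x0; rewrite add0r.
    have [k [C [CA /ltW Cx]]] := gammaCP_lt n0 (le_lt_trans gn x0).
    exact: le_trans (cp_entry_le i d1 CA) Cx.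
  exists A; split=> [t|i]; last by rewrite subrr normr0 mulr_ge0 // ltW.
  by rewrite (_ : unfolding A t = 0) ?mxrank0 //; apply/matrixP=> p q; rewrite !mxE A0.
have g2 : gammaCP A < 2 * gammaCP A by lra.
have [k [C [CA Cg]]] := gammaCP_lt n0 g2.
pose h : R := 2 ^+ d.+1; have h1 : 1 <= h by rewrite exprn_ege1 // ler1n.
have h0 : 0 < h by lra.
have [|||B [rB AB]] := @cp_approximation R d k `|r|%N n C A (eps / h) CA.
- by rewrite divr_gt0 // ler_pdivrMr // mul1r (le_trans (ltW e1)).
- by rewrite absz_gt0 gt_eqF.
- rewrite card_multi_index union_bound_lt1 //.
  have : 100 * h ^+ 2 / eps ^+ 2 * lg <= `|r|%N%:R.
    by rewrite -[leRHS](_ : r%:~R = _) ?ceil_ge // [in LHS]rE.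
  move: (`|r|%N%:R : R) => rr.
  rewrite mulrAC ler_pdivrMr ?exprn_gt0 // => H; rewrite -/lg.
  rewrite ler_pdivlMr // expr_div_n [leRHS]mulrAC ler_pdivlMr ?exprn_gt0 //; lra.
exists B; split=> // i; apply: le_trans (AB i) _.
have d0 : (2 ^+ d : R) != 0 by rewrite expf_eq0 pnatr_eq0 andbF.
have -> : eps / h * 2 ^+ d = eps / 2 by rewrite /h exprS; field.
rewrite -mulrA; apply: ler_wpM2l; [exact: ltW|lra].
Qed.
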